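(* Let $m\ge 2$, $n\geq 2$, let $\mathcal{A}=(a_{i_1\cdots i_m})\in C^{[m,n]}$ be a complex tensor of order $m$ and dimension $n$, let $N=\{1,\ldots,n\}$, and let $S$ be a nonempty proper subset of $N$ with complement $\bar S=N\setminus S$. Then $$\sigma(\mathcal{A})\subseteq \Omega^S(\mathcal{A}):=\left(\bigcup_{i\in S,\ j\in\bar S}\Omega^S_{i,j}(\mathcal{A})\right)\bigcup\left(\bigcup_{i\in\bar S,\ j\in S}\Omega^{\bar S}_{i,j}(\mathcal{A})\right),$$ where $$\Omega^S_{i,j}(\mathcal{A}):=\left\{z\in\mathbb{C}: |z-a_{i\cdots i}|\left(|z-a_{j\cdots j}|-r_j^{\overline{\Delta^S}}(\mathcal{A})\right)\leq r_i(\mathcal{A})\,r_j^{\Delta^S}(\mathcal{A})\right\}$$ and $$\Omega^{\bar S}_{i,j}(\mathcal{A}):=\left\{z\in\mathbb{C}: |z-a_{i\cdots i}|\left(|z-a_{j\cdots j}|-r_j^{\overline{\Delta^{\bar S}}}(\mathcal{A})\right)\leq r_i(\mathcal{A})\,r_j^{\Delta^{\bar S}}(\mathcal{A})\right\}.$$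
   Context: A complex tensor $\mathcal{A}=(a_{i_1\cdots i_m})\in C^{[m,n]}$ of order $m$ and dimension $n$ is an array of complex numbers $a_{i_1\cdots i_m}$ with each $i_k\in N=\{1,\ldots,n\}$. No symmetry is assumed. Eigenvalues: $\lambda\in\mathbb{C}$ is an eigenvalue of $\mathcal{A}$ if there is a nonzero $x=(x_1,\ldots,x_n)^T\in\mathbb{C}^n$ with $\mathcal{A}x^{m-1}=\lambda x^{[m-1]}$, where $(\mathcal{A}x^{m-1})_i=\sum_{i_2,\ldots,i_m\in N}a_{ii_2\cdots i_m}x_{i_2}\cdots x_{i_m}$ for $i\in N$ and $x^{[m-1]}=(x_1^{m-1},\ldots,x_n^{m-1})^T$. $\sigma(\mathcal{A})$ denotes the set of all eigenvalues of $\mathcal{A}$. Let $\delta_{i_1\cdots i_m}=1$ if $i_1=\cdots=i_m$ and $0$ otherwise. For $i\in N$, $$r_i(\mathcal{A})=\sum_{i_2,\ldots,i_m\in N,\ \delta_{ii_2\cdots i_m}=0}|a_{ii_2\cdots i_m}|.$$ For a nonempty proper subset $T\subset N$ (here $T=S$ or $T=\bar S$), let $\Delta^N=\{(i_2,\ldots,i_m): i_k\in N \text{ for } k=2,\ldots,m\}$, $\Delta^T=\{(i_2,\ldots,i_m): i_k\in T\text{ for }k=2,\ldots,m\}$, and $\overline{\Delta^T}=\Delta^N\setminus\Delta^T$. For $i\in N$, $$r_i^{\Delta^T}(\mathcal{A})=\sum_{(i_2,\ldots,i_m)\in\Delta^T,\ \delta_{ii_2\cdots i_m}=0}|a_{ii_2\cdots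 i_m}|,\qquad r_i^{\overline{\Delta^T}}(\mathcal{A})=\sum_{(i_2,\ldots,i_m)\in\overline{\Delta^T},\ \delta_{ii_2\cdots i_m}=0}|a_{ii_2\cdots i_m}|,$$ so that $r_i(\mathcal{A})=r_i^{\Delta^T}(\mathcal{A})+r_i^{\overline{\Delta^T}}(\mathcal{A})$. *)

(* Defs.v *)
From mathcomp Require Import all_boot all_order all_algebra.
From mathcomp Require Import classical_sets reals.
From mathcomp Require Import complex.

Set Implicit Arguments.
Unset Strict Implicit.
Unset Printing Implicit Defensive.

Import Order.TTheory GRing.Theory Num.Theory.

Local Open Scope ring_scope.
Local Open Scope complex_scope.
Local Open Scope classical_set_scope.

(* [A i t] is the entry a_{i i_2 ... i_m} with t = (i_2, ..., i_m); since the
   tail has m.-1 indices, the order is m as soon as 0 < m. *)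
Definition tensor (R : realType) (m n : nat) : Type :=
  'I_n -> (m.-1).-tuple 'I_n -> R[i].

Section Tensor.
Context {R : realType} {m n : nat}.
Implicit Types (A : tensor R m n) (x : 'cV[R[i]]_n) (i j : 'I_n).
Implicit Types (t : (m.-1).-tuple 'I_n) (T : {set 'I_n}).

Definition tensor_app A x : 'cV[R[i]]_n :=
  \col_i \sum_(t : (m.-1).-tuple 'I_n)
    A i t * \prod_(k < m.-1) x (tnth t k) 0.

Definition hadamard_exp x (k : nat) : 'cV[R[i]]_n := \col_i x i 0 ^+ k.

Definition tensor_eigenvalue A (lambda : R[i]) : Prop :=
  exists2 x : 'cV[R[i]]_n,
    x != 0 & tensor_app A x = lambda *: hadamard_exp x m.-1.

Definition spectrum A : set R[i] := [set lambda | tensor_eigenvalue A lambda].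

Definition delta i t : bool := all (pred1 i) t.

Definition diag A i : R[i] := A i [tuple of nseq m.-1 i].

Definition Delta T : {set (m.-1).-tuple 'I_n} :=
  [set t : (m.-1).-tuple 'I_n | all (mem T) t]%SET.

(* Absolute values, hence the sums below, are real elements of R[i]; on these
   the partial order of R[i] is the order of R. *)
Definition row_sum A i : R[i] :=
  \sum_(t : (m.-1).-tuple 'I_n | ~~ delta i t) `|A i t|.

Definition row_sum_on (D : {set (m.-1).-tuple 'I_n}) A i : R[i] :=
  \sum_(t in D | ~~ delta i t) `|A i t|.

Definition Omega_pair T A i j : set R[i] :=
  [set z | `|z - diag A i| * (`|z - diag A j| - row_sum_on (~: Delta T) A j)
           <= row_sum A i * row_sum_on (Delta T) A j].

Definition Omega (S : {set 'I_n}) A : set R[i] :=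
  (\bigcup_(i in [set` S]) \bigcup_(j in [set` ~: S]) Omega_pair S A i j) `|`
  (\bigcup_(i in [set` ~: S]) \bigcup_(j in [set` S]) Omega_pair (~: S) A i j).

End Tensor.

(* Main.v *)
Require Import Defs.
From mathcomp Require Import all_boot all_order all_algebra.
From mathcomp Require Import classical_sets reals.
From mathcomp Require Import complex.

(** An eigenvector [x] for [lambda] satisfies, in each row [i],
    [(lambda - a_{i...i}) x_i^(m-1) = sum of the off-diagonal terms], so
    [|lambda - a_{i...i}| |x_i|^(m-1)] is at most the sum of
    [|a_{i i_2...i_m}| |x_{i_2}| ... |x_{i_m}|] over the off-diagonal tuples
    ([eigen_row_le]).  Let [j] be an index at which [|x|] is maximal, let [T]
    be the one of [S] and its complement that does not contain [j], and let [i]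
    maximize [|x|] over [T].  With [u = |x_j|^(m-1)] and [v = |x_i|^(m-1)],
    a tuple with all its entries in [T] contributes at most [v] and any other
    tuple at most [u]; rows [j] and [i] thus give
    - [(|lambda - a_{j...j}| - r_j(not Delta T)) u <= r_j(Delta T) v],
    - [|lambda - a_{i...i}| v <= r_i u].
    Multiplying the first by [|lambda - a_{i...i}|], inserting the second, and
    cancelling [u], which is positive because [x] is nonzero, puts [lambda] in
    the set of the pair [(i, j)] ([Omega_pair_of_max]).  Since [v] is never
    cancelled, the possibility that [x] vanishes on [T] needs no separate
    treatment. *)

Set Implicit Arguments.
Unset Strict Implicit.
Unset Printing Implicit Defensive.

Import Order.TTheory GRing.Theory Num.Theory.

Local Open Scope ring_scope.
Local Open Scope classical_set_scope.

(** The order of [R[i]] is partial, so a maximizer of [|x|] is chosen through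
    the [R]-valued modulus. *)
Lemma exists_max_norm (R : realType) (I : finType) (T : {set I})
    (f : I -> R[i]) (i0 : I) :
  i0 \in T ->
  exists2 i, i \in T & forall k, k \in T -> `|f k| <= `|f i|.
Proof.
move=> i0T.
case: (Order.TotalTheory.arg_maxP (fun k => complex.Re `|f k|) i0T) => i iT imax.
exists i => // k kT.
have : complex.Re `|f k| <= complex.Re `|f i| by exact: imax.
by rewrite -lecR !RRe_real ?normr_real.
Qed.

Section Tensor.
Context {R : realType} {m n : nat}.
Implicit Types (A : tensor R m n) (x : 'cV[R[i]]_n) (i j : 'I_n).
Implicit Types (t : (m.-1).-tuple 'I_n) (T : {set 'I_n}).

Lemma deltaE i t : delta i t = (t == [tuple of nseq m.-1 i]).
Proof.
by rewrite -val_eqE /= /delta (sameP (all_pred1P _ _) eqP) size_tuple.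
Qed.

Lemma tensor_app_diag A x i :
  tensor_app A x i 0 = diag A i * x i 0 ^+ m.-1
    + \sum_(t | ~~ delta i t) A i t * \prod_(k < m.-1) x (tnth t k) 0.
Proof.
rewrite mxE (bigD1 [tuple of nseq m.-1 i]) //=; congr (_ + _).
  congr (_ * _); rewrite (eq_bigr (fun=> x i 0)) ?prodr_const ?card_ord //.
  by move=> k _; rewrite (tnth_nth i) /= nth_nseq ltn_ord.
by apply: eq_bigl => t; rewrite deltaE.
Qed.

Lemma eigen_row_le A x lambda i :
  tensor_app A x = lambda *: hadamard_exp x m.-1 ->
  `|lambda - diag A i| * `|x i 0| ^+ m.-1
    <= \sum_(t | ~~ delta i t) `|A i t| * \prod_(k < m.-1) `|x (tnth t k) 0|.
Proof.
move=> /matrixP/(_ i 0); rewrite tensor_app_diag !mxE => Ex.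
rewrite -normrX -normrM mulrBl -Ex addrC addKr.
apply: le_trans (ler_norm_sum _ _ _) _; apply: ler_sum => t _.
by rewrite normrM normr_prod.
Qed.

Lemma prod_norm_le x t (c : R[i]) :
  (forall k, k \in t -> `|x k 0| <= c) ->
  \prod_(k < m.-1) `|x (tnth t k) 0| <= c ^+ m.-1.
Proof.
move=> xc; rewrite -[X in c ^+ X]card_ord -prodr_const.
by apply: ler_prod => k _; rewrite normr_ge0 xc ?mem_tnth.
Qed.

(** [T] stands for [S] or for its complement, whichever omits the index [j] of
    a globally largest entry; the two unions in [Omega] come from these two
    cases.  No sign of [Q - row_sum_on (~: Delta T) A j] is assumed: both sides
    of [rowj] are multiplied by [P], which is nonnegative. *)
Lemma Omega_pair_of_max A x lambda T i j :
  x != 0 -> tensor_app A x = lambda *: hadamard_exp x m.-1 ->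
  (forall k, k \in T -> `|x k 0| <= `|x i 0|) ->
  (forall k, `|x k 0| <= `|x j 0|) ->
  Omega_pair T A i j lambda.
Proof.
move=> x0 Ex maxi maxj; rewrite /Omega_pair /=.
set P := `|lambda - diag A i|; set Q := `|lambda - diag A j|.
have xj_gt0 : 0 < `|x j 0|.
  rewrite normr_gt0; apply: contraNneq x0 => xj0.
  apply/eqP/matrixP => k l; rewrite (ord1 l) mxE; apply/eqP.
  by rewrite -normr_le0 -(normr0 R[i]) -xj0.
have rowi : P * `|x i 0| ^+ m.-1 <= row_sum A i * `|x j 0| ^+ m.-1.
  apply: le_trans (eigen_row_le i Ex) _; rewrite mulr_suml.
  by apply: ler_sum => t _; apply: ler_wpM2l => //; apply: prod_norm_le.
have rowj : (Q - row_sum_on (~: Delta T) A j) * `|x j 0| ^+ m.-1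
            <= row_sum_on (Delta T) A j * `|x i 0| ^+ m.-1.
  rewrite mulrBl lerBlDr; apply: le_trans (eigen_row_le j Ex) _.
  rewrite (bigID (mem (Delta T))) /= !mulr_suml; apply: lerD.
    rewrite (eq_bigl _ _ (fun t => andbC _ _)).
    apply: ler_sum => t /andP[]; rewrite inE => /allP tT _.
    apply: ler_wpM2l => //; apply: prod_norm_le => k /tT; exact: maxi.
  rewrite (eq_bigl (fun t => (t \in ~: Delta T) && ~~ delta j t)); last first.
    by move=> t; rewrite andbC [in RHS]inE.
  by apply: ler_sum => t _; apply: ler_wpM2l => //; apply: prod_norm_le.
have r_ge0 : 0 <= row_sum_on (Delta T) A j by apply: sumr_ge0.
rewrite -(ler_pM2r (exprn_gt0 m.-1 xj_gt0)) -mulrA.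
apply: le_trans (ler_wpM2l (normr_ge0 _) rowj) _.
by rewrite mulrCA [leRHS]mulrAC mulrC ler_wpM2r.
Qed.

End Tensor.

Theorem theorem4 (R : realType) (m n : nat) (hm : (2 <= m)%N) (hn : (2 <= n)%N)
    (A : tensor R m n) (S : {set 'I_n})
    (hS0 : S != finset.set0) (hST : S \proper [set: 'I_n]%SET) :
  spectrum A `<=` Omega S A.
Proof.
move=> lambda [x x0 Ex].
have /set0Pn[s sS] := hS0; have /properP[_ [s' _ s'S]] := hST.
have s'C : s' \in ~: S by rewrite inE.
have [j _ maxj] := exists_max_norm (fun k => x k 0) (finset.in_setT s).
have {}maxj k : `|x k 0| <= `|x j 0| by rewrite maxj ?finset.in_setT.
have [jS|jS] := boolP (j \in S).
- have [i iC maxi] := exists_max_norm (fun k => x k 0) s'C.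
  right; exists i => //; exists j => //; exact: Omega_pair_of_max x0 Ex maxi maxj.
- have [i iS maxi] := exists_max_norm (fun k => x k 0) sS.
  left; exists i => //; exists j; first by rewrite /= inE.
  exact: Omega_pair_of_max x0 Ex maxi maxj.
Qed.
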